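(* Let $n\ge 1$ and $r\ge 2$ be integers, and let $\Delta_1,\ldots,\Delta_r$ be $r$ simplices of dimension $n-1$. Suppose the product $\Delta_1\times\Delta_2\times\dots\times\Delta_r$ is covered by $n^r$ sets $A_{i_1\dots i_r}$ $((i_1,\ldots,i_r)\in[n]^r)$, either all open or all closed (in the product), such that for every $(i_1,\ldots,i_r)\in[n]^r$ and every $l\in[r]$ the set $A_{i_1\dots i_r}$ does not intersect $$\Delta_1\times\dots\times\Delta_{l-1}\times\partial_{i_l}\Delta_l\times\Delta_{l+1}\times\dots\times\Delta_r.$$ Then there is a matching $M$ on $H(n,r)$ of size at least $\left\lceil\frac{n}{r-1}\right\rceil$ such that the sets of the family $\{A_{i_1\dots i_r}:(i_1,\ldots,i_r)\in M\}$ have a common point.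
   Context: $[n]=\{1,2,\ldots,n\}$. The points of a $d$-dimensional geometric simplex $\Delta$ are given by barycentric coordinates $(t_1,\ldots,t_{d+1})$ with all $t_i\ge 0$ and $\sum_{i=1}^{d+1}t_i=1$; $\partial_i\Delta=\{(t_1,\ldots,t_{d+1})\in\Delta: t_i=0\}$ is its $i$-th facet. $H(n,r)$ denotes the full $r$-partite $r$-uniform hypergraph on the vertex set that is the disjoint union of $r$ copies of $[n]$; its edge set is $E(H(n,r))=[n]^r$, where $(i_1,\ldots,i_r)$ is the edge containing the vertex $i_k$ of the $k$-th copy for each $k\in[r]$. A matching on a hypergraph $H$ is a subset $M\subseteq E(H)$ such that any two distinct members of $M$ are disjoint; in $H(n,r)$ this means that any two distinct elements of $M$ differ in every coordinate. *)

(* Defs.v *)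
From HB Require Import structures.
From mathcomp Require Import all_boot all_order all_algebra.
From mathcomp Require Import all_classical all_reals all_analysis.
Set Implicit Arguments.
Unset Strict Implicit.
Unset Printing Implicit Defensive.
Import Order.TTheory GRing.Theory Num.Theory.
Import numFieldNormedType.Exports.
Local Open Scope classical_set_scope.
Local Open Scope ring_scope.

Definition affinely_independent (R : realType) (m n : nat)
    (v : 'I_n -> 'rV[R]_m) : Prop :=
  forall c : 'I_n -> R,
    \sum_i c i = 0 -> \sum_i c i *: v i = 0 -> forall i, c i = 0.

Definition barycentric (R : realType) (n : nat) : set ('I_n -> R) :=
  [set t | (forall i, 0 <= t i) /\ \sum_i t i = 1].

Definition bary_point (R : realType) (m n : nat) (v : 'I_n -> 'rV[R]_m)
    (t : 'I_n -> R) : 'rV[R]_m :=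
  \sum_i t i *: v i.

(* For affinely independent vertices v : 'I_n -> 'rV_m this is a geometric
   simplex of dimension n - 1. *)
Definition simplex (R : realType) (m n : nat) (v : 'I_n -> 'rV[R]_m) :
    set 'rV[R]_m :=
  [set bary_point v t | t in @barycentric R n].

Definition facet (R : realType) (m n : nat) (v : 'I_n -> 'rV[R]_m)
    (i : 'I_n) : set 'rV[R]_m :=
  [set bary_point v t | t in [set t | @barycentric R n t /\ t i = 0]].

Definition ambient (R : realType) (r : nat) (m : 'I_r -> nat) : topologicalType :=
  prod_topology (fun l : 'I_r => 'rV[R]_(m l) : topologicalType).

Definition box (R : realType) (r : nat) (m : 'I_r -> nat)
    (D : forall l, set 'rV[R]_(m l)) : set (ambient R m) :=
  [set x : forall l, 'rV[R]_(m l) | forall l, D l (x l)].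

Definition simplex_product (R : realType) (n r : nat) (m : 'I_r -> nat)
    (v : forall l, 'I_n -> 'rV[R]_(m l)) : set (ambient R m) :=
  box (fun l => simplex (v l)).

(* dfwith D l B is the family D with its l-th member replaced by B, so this is
   the product of the simplices with the l-th factor replaced by its i-th
   facet. *)
Definition facet_slab (R : realType) (n r : nat) (m : 'I_r -> nat)
    (v : forall l, 'I_n -> 'rV[R]_(m l)) (l : 'I_r) (i : 'I_n) :
    set (ambient R m) :=
  box (dfwith (fun k => simplex (v k)) l (facet (v l) i)).

(* The vertices of H(n,r) are the pairs (k, j), vertex j of the k-th copy of
   [n]. An edge is encoded by its index tuple, which determines its vertex
   set. *)
Definition edge (n r : nat) := {ffun 'I_r -> 'I_n}.

Definition edge_vertices (n r : nat) (e : edge n r) : {set 'I_r * 'I_n} :=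
  [set (k, e k) | k : 'I_r]%SET.

Definition is_matching (n r : nat) (M : {set edge n r}) : Prop :=
  forall e f : edge n r, e \in M -> f \in M -> e != f ->
    (edge_vertices e :&: edge_vertices f = finset.set0)%SET.

(* Main.v *)
From HB Require Import structures.
Require Import Defs.
From mathcomp Require Import all_boot all_order all_algebra.
From mathcomp Require Import ring lra zify.
Set Implicit Arguments.
Unset Strict Implicit.
Unset Printing Implicit Defensive.
Import Order.TTheory GRing.Theory Num.Theory.

(* In barycentric coordinates, give each set a continuous weight supported near
   it. The marginals of the weights vanish on the facets, so a Sperner-type
   argument yields a point where no vertex of H(n,r) carries more than 1/n of
   the total weight: after scaling, the weights form a fractional matching of
   size n whose support consists of edges with sets near that point. Furedi's
   theorem turns it into a matching of size at least n / (r - 1), and a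
   compactness argument replaces "near" by "in".

   The Sperner-type result is the existence, for a closed cover (F_i) of the
   simplex, of a point z with z_i = 0 or z in F_i for every i. It follows from
   Scarf's lemma on families of linear orders applied to the points of a fine
   grid ordered by their coordinates, so no triangulation is needed. *)

(** * Scarf's lemma *)

Section Dominance.
Variables (P I : finType) (rk : I -> P -> nat).
Hypothesis rk_inj : forall i, injective (rk i).

(** Scarf's condition: for nonempty [U], no point is strictly above the minimum of [U] in all orders
    at once. Dominant sets act as the faces of a triangulation. *)
Definition dominant (U : {set P}) :=
  [forall y, exists i, [forall (x | x \in U), rk i y <= rk i x]].

Lemma dominantP (U : {set P}) :
  reflect (forall y, exists i, forall x, x \in U -> rk i y <= rk i x)
          (dominant U).
Proof.
apply: (iffP forallP) => h y; have := h y.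
  by case/existsP => i /forall_inP hi; exists i.
by case=> i hi; apply/existsP; exists i; apply/forall_inP.
Qed.

Lemma dominantS (U V : {set P}) : U \subset V -> dominant V -> dominant U.
Proof.
move=> /subsetP UV /dominantP dV; apply/dominantP => y.
by have [i hi] := dV y; exists i => x /UV; apply: hi.
Qed.

Lemma exists_rank_min (U : {set P}) : U != set0 ->
  exists mn : I -> P, forall i, mn i \in U /\
    forall x, x \in U -> rk i (mn i) <= rk i x.
Proof.
case/set0Pn => x0 x0U; exists (fun i => [arg min_(x < x0 in U) rk i x]) => i.
by case: arg_minnP.
Qed.

Section Minima.
Variables (U : {set P}) (mn : I -> P).
Hypothesis mnP : forall i, mn i \in U /\
  forall x, x \in U -> rk i (mn i) <= rk i x.

Lemma rank_min_eq i x :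
  x \in U -> (forall y, y \in U -> rk i x <= rk i y) -> mn i = x.
Proof.
move=> xU hx; apply: (@rk_inj i); apply/eqP; rewrite eqn_leq.
by rewrite (mnP i).2 // hx // (mnP i).1.
Qed.

(** Dominance applied to a member [x] of [U] makes [x] the minimum of [U] in some order, so [U] has
    at most [#|I|] points. *)
Lemma dominant_minima : dominant U -> [set mn i | i : I] = U.
Proof.
move=> /dominantP dU; apply/setP => x; apply/imsetP/idP => [[i _ ->]|xU].
  exact: (mnP i).1.
by have [i hi] := dU x; exists i => //; rewrite (rank_min_eq xU).
Qed.

End Minima.

(** Rooms are the full-dimensional cells; a set [D] with one point less is a door to the rooms that
    contain it. *)
Definition rooms (D : {set P}) :=
  [set U : {set P} | [&& dominant U, #|U| == #|I| & D \subset U]].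

Lemma rooms_addP (D U : {set P}) : #|D|.+1 = #|I| ->
  reflect (exists2 y, y \notin D & U = y |: D /\ dominant (y |: D))
          (U \in rooms D).
Proof.
move=> cD; rewrite inE; apply: (iffP and3P) => [[dU /eqP cU DU]|[y yD [-> dU]]].
  have /eqP : #|U :\: D| = 1.
    by have := cardsID D U; rewrite (setIidPr DU) cU -cD -addn1 => /addnI.
  case/cards1P => y hy.
  have yD : y \notin D by have := set11 y; rewrite -hy inE => /andP[].
  have DyU : y |: D = U by rewrite -hy setUC -{1}(setIidPr DU) setID.
  by exists y => //; rewrite DyU.
by split=> //; [rewrite cardsU1 yD add1n cD|exact: subsetU1].
Qed.

Section Door.
Variable D : {set P}.
Hypothesis cardD : #|D|.+1 = #|I|.
Variable mn : I -> P.
Hypothesis mnP : forall i, mn i \in D /\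
  forall x, x \in D -> rk i (mn i) <= rk i x.

(** Adding such a point to [D] leaves the minima in the orders other than [a] unchanged. *)
Definition above a := [set y | [forall (j | j != a), rk j (mn j) < rk j y]].

Lemma aboveP a y :
  reflect (forall j, j != a -> rk j (mn j) < rk j y) (y \in above a).
Proof. by rewrite inE; exact: forall_inP. Qed.

Definition top_above a y := y \in above a /\
  forall w, w \in above a -> rk a w <= rk a y.

Hypothesis domD : dominant D.

(** A point of [above a] can be dominated by [D] only in order [a], where [y] is the largest
    candidate; any other point stays below a minimum that [y] does not change. The minimum shared by
    [a] and [b] keeps [y] out of [D]. *)
Lemma top_above_dominant a b y : a != b -> mn a = mn b -> top_above a y ->
  y \notin D /\ dominant (y |: D).
Proof.
move=> ab mab [/aboveP yS ymax]; split.
  apply/negP; rewrite -{1}(dominant_minima mnP domD) => /imsetP[j _ yj].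
  have [ja|ja] := eqVneq j a; last by have := yS j ja; rewrite -yj ltnn.
  by have := yS b; rewrite eq_sym ab -mab -ja -yj ltnn => /(_ isT).
apply/dominantP => w.
have [wS|] := boolP (w \in above a).
  have [j hj] := dominantP _ domD w; exists a => x; rewrite in_setU1.
  case/predU1P => [->|xD]; first exact: ymax.
  have [<-|ja] := eqVneq j a; first exact: hj.
  have := hj _ (mnP j).1; rewrite leqNgt.
  by move/aboveP : wS => /(_ _ ja) ->.
rewrite inE negb_forall_in => /existsP[j /andP[ja]]; rewrite -leqNgt => wj.
exists j => x; rewrite in_setU1 => /predU1P[->|xD].
  exact: leq_trans wj (ltnW (yS _ ja)).
exact: leq_trans wj ((mnP j).2 _ xD).
Qed.

(** The minima of [y |: D] in the various orders are distinct, so [y] is the minimum in a single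
    order [i] and every other order keeps its minimum. As [a] and [b] had the same one, [i] is [a]
    or [b]. *)
Lemma dominant_top_above a b y : a != b -> mn a = mn b ->
  y \notin D -> dominant (y |: D) -> top_above a y \/ top_above b y.
Proof.
move=> ab mab yD dU.
have U0 : y |: D != set0 by apply/set0Pn; exists y; rewrite setU11.
have [mU mUP] := exists_rank_min U0.
have mUI : injective mU.
  have /imset_injP h : #|[set mU i | i : I]| == #|I|.
    by rewrite (dominant_minima mUP dU) cardsU1 yD add1n cardD.
  by move=> i j; apply: h.
have : y \in [set mU i | i : I] by rewrite (dominant_minima mUP dU) setU11.
case/imsetP => i _ yi.
have mUj j : j != i -> mU j = mn j.
  move=> ji; have := (mUP j).1; rewrite in_setU1 => /predU1P[|mD].
    by rewrite yi => /mUI/eqP; rewrite (negbTE ji).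
  apply/esym/(rank_min_eq mnP) => // x xD.
  by apply: (mUP j).2; rewrite setU1r.
have iab : (i == a) || (i == b).
  apply/norP => -[ia ib]; move/eqP : ab; apply; apply: mUI.
  by rewrite !mUj // eq_sym.
have ti : top_above i y.
  have yS : y \in above i.
    apply/aboveP => j ji; rewrite -mUj // ltn_neqAle (mUP j).2 ?setU11 // andbT.
    apply/negP => /eqP/rk_inj; rewrite yi => /mUI/eqP.
    by rewrite (negbTE ji).
  split=> // w /aboveP wS; have [j hj] := dominantP _ dU w.
  have [<-|ji] := eqVneq j i; first by apply: hj; rewrite setU11.
  have := hj (mn j); rewrite setU1r ?(mnP j).1 // => /(_ isT).
  by rewrite leqNgt wS.
by case/orP : iab => /eqP <-; [left|right].
Qed.

(** [D] has one point fewer than there are orders, so two orders [a] and [b] share a minimum. The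
    rooms arise by adding the top of [above a] or of [above b]; the two tops differ, since a common
    one would violate the dominance of [D]. *)
Lemma card_rooms_inner : (forall a, exists y, y \in above a) -> #|rooms D| = 2.
Proof.
move=> S0.
have [a [b [ab mab]]] : exists a b, a != b /\ mn a = mn b.
  have : ~~ injectiveb mn.
    apply/negP => /injectiveP mnI.
    have := card_imset I mnI; rewrite (dominant_minima mnP domD) -cardD.
    by move/eqP; rewrite -[X in X == _]addn0 -addn1 eqn_add2l.
  by case/injectivePn => a [b ab mab]; exists a, b; rewrite mab.
have top c : exists y, top_above c y.
  have [y0 y0S] := S0 c; exists [arg max_(y > y0 in above c) rk c y].
  by case: arg_maxnP.
have [ya ta] := top a; have [yb tb] := top b.
have [yaD dya] := top_above_dominant ab mab ta.
have [ybD dyb] : yb \notin D /\ dominant (yb |: D).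
  by apply: (@top_above_dominant b a) => //; rewrite eq_sym.
have top_uniq c y y' : top_above c y -> top_above c y' -> y = y'.
  move=> [yS ym] [yS' ym']; apply: (@rk_inj c); apply/eqP.
  by rewrite eqn_leq ym // ym'.
have yab : ya != yb.
  apply/eqP => yab; have [j hj] := dominantP _ domD ya.
  have [ja|ja] := eqVneq j a; last first.
    by have := hj _ (mnP j).1; rewrite leqNgt; move/aboveP : ta.1 => ->.
  have := hj _ (mnP j).1; rewrite leqNgt yab; move/aboveP : tb.1 => -> //.
  by rewrite ja.
rewrite (_ : rooms D = [set ya |: D; yb |: D]).
  rewrite cards2; case: eqP => // /setP/(_ ya); rewrite setU11 in_setU1.
  by rewrite (negbTE yab) (negbTE yaD).
apply/setP => U; rewrite in_set2; apply/(rooms_addP _ cardD)/orP.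
  move=> [y yD [-> dU]]; case: (dominant_top_above ab mab yD dU) => ty.
    by left; rewrite (top_uniq _ _ _ ty ta).
  by right; rewrite (top_uniq _ _ _ ty tb).
by case=> /eqP ->; [exists ya|exists yb].
Qed.

End Door.
End Dominance.

(** * Parity count of doors with all colours but one *)

Lemma odd_sum (J : finType) (F : J -> nat) :
  odd (\sum_j F j) = odd #|[set j | odd (F j)]|.
Proof.
rewrite -sum1_card (big_morph odd oddD (erefl (odd 0))).
rewrite (big_morph odd oddD (erefl (odd 0))) [RHS]big_mkcond /=.
by apply: eq_bigr => j _; rewrite inE; case: (odd (F j)).
Qed.

Section ColourCount.
Variables (P I : finType) (c : P -> I) (i0 : I).

Definition almost_rainbow (U : {set P}) :=
  [set D : {set P} | [&& D \subset U, #|D|.+1 == #|I| & c @: D == [set~ i0]]].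

(** The local step of Sperner's parity argument. A rainbow [U] has one such door, obtained by
    removing its point of colour [i0]. A [U] that is not rainbow but has a door repeats exactly one
    colour, and removing either of the two points gives a door. *)
Lemma odd_card_almost_rainbow (U : {set P}) : #|U| = #|I| ->
  odd #|almost_rainbow U| = (c @: U == [set: I]).
Proof.
move=> cU.
have door D : D \in almost_rainbow U -> exists2 x, x \in U & D = U :\ x.
  rewrite inE => /and3P[DU /eqP cD _].
  have /eqP : #|U :\: D| = 1.
    by have := cardsID D U; rewrite (setIidPr DU) cU -cD -addn1 => /addnI.
  case/cards1P => x hx; have := set11 x; rewrite -hx inE => /andP[xD xU].
  by exists x => //; rewrite -hx setDDr setDv set0U (setIidPr DU).
have cardU x : x \in U -> #|U :\ x|.+1 == #|I|.
  by move=> xU; rewrite -cU (cardsD1 x U) xU.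
have [cUT|cUT] := eqVneq (c @: U) setT.
  have cI : {in U &, injective c}.
    by apply/imset_injP; rewrite cUT cardsT cU.
  have : i0 \in c @: U by rewrite cUT inE.
  case/imsetP => x xU ix.
  rewrite (_ : almost_rainbow U = [set U :\ x]) ?cards1 //.
  apply/setP => D; rewrite in_set1; apply/idP/eqP => [hD|->].
    have [y yU Dy] := door _ hD; have := hD; rewrite inE => /and3P[_ _ /eqP hc].
    have : i0 \notin c @: D by rewrite hc !inE eqxx.
    have [<- //|yx] := eqVneq y x.
    by rewrite ix imset_f // Dy !inE xU eq_sym yx.
  rewrite inE subD1set cardU //=; apply/eqP/setP => i; rewrite !inE.
  apply/imsetP/idP => [[z]|ii0].
    rewrite !inE => /andP[zx zU] ->; apply: contraNneq zx.
    by rewrite ix => /cI ->.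
  have : i \in c @: U by rewrite cUT inE.
  case/imsetP => z zU iz; exists z => //; rewrite !inE zU andbT.
  by apply: contraNneq ii0 => zx; rewrite iz zx ix.
have [->|] := set_0Vmem (almost_rainbow U); first by rewrite cards0.
case=> D hD; have [x xU Dx] := door _ hD.
have := hD; rewrite inE => /and3P[DU cD /eqP hc].
have cI : {in D &, injective c}.
  by apply/imset_injP; rewrite hc cardsC1 -(eqP cD).
have UxD : U = x |: D by rewrite Dx setD1K.
(* Otherwise [x] would have colour [i0] and [U] would be rainbow. *)
have cx : c x \in c @: D.
  rewrite hc !inE; apply: contraNneq cUT => cxi.
  by rewrite UxD imsetU1 hc cxi; apply/eqP/setP => i; rewrite !inE orbN.
case/imsetP : (cx) => y yD cxy.
have yU : y \in U by move/subsetP : DU; apply.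
have xD : x \notin D by rewrite Dx !inE eqxx.
have xy : x != y by apply: contraNneq xD => ->.
rewrite (_ : almost_rainbow U = [set U :\ x; U :\ y]).
  rewrite cards2; case: eqP => // /setP/(_ x).
  by rewrite !inE eqxx xU xy.
apply/setP => D'; rewrite in_set2; apply/idP/orP => [hD'|[/eqP ->|/eqP ->]].
- have [z zU D'z] := door _ hD'; rewrite D'z.
  have [->|zx] := eqVneq z x; first by left.
  have [->|zy] := eqVneq z y; first by right.
  have cD'I : {in U :\ z &, injective c}.
    have := hD'; rewrite D'z inE => /and3P[_ cD' /eqP hc'].
    by apply/imset_injP; rewrite hc' cardsC1 -(eqP cD').
  move/eqP : xy; case; apply: cD'I => //.
    by rewrite !inE xU eq_sym zx.
  by rewrite !inE yU eq_sym zy.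
- by rewrite -Dx.
rewrite inE subD1set cardU //=; apply/eqP.
rewrite -hc; apply/setP => i; apply/imsetP/imsetP => -[z].
  rewrite UxD !inE => /andP[zy /predU1P[->|zD]] ->; first by exists y.
  by exists z.
move=> zD ->; have [->|zy] := eqVneq z y.
  by exists x => //; rewrite !inE xy.
by exists z => //; rewrite UxD !inE zy zD orbT.
Qed.
End ColourCount.

Section Scarf.
Variables (T I : finType) (t0 : T) (i0 : I) (rk : I -> T -> nat).
Variable c : T -> I.
Hypothesis rk_inj : forall i, injective (rk i).

(* Scarf's slack points: the slack [inr i] is the least element of the [i]-th
   order and lies above all of [T] in the other ones. *)
Definition slack_rank (i : I) (p : T + I) : nat :=
  match p with
  | inl t => (rk i t).+1
  | inr j => if j == i then 0
             else (\max_k \max_t rk k t + enum_rank j).+2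
  end.

Definition slack_colour (p : T + I) : I :=
  match p with inl t => c t | inr i => i end.

Lemma slack_rank_lt j i t : j != i ->
  slack_rank j (inl t) < slack_rank j (inr i).
Proof.
move=> ji /=; rewrite eq_sym (negbTE ji) !ltnS.
apply: leq_trans (leq_addr _ _).
by apply: leq_trans (leq_bigmax j); exact: (leq_bigmax t).
Qed.

Lemma slack_rank_inj i : injective (slack_rank i).
Proof.
move=> [t|j] [t'|j'].
- by case=> /rk_inj ->.
- have [->|ij] := eqVneq i j'; first by rewrite /= eqxx.
  by move=> h; have := slack_rank_lt t ij; rewrite h ltnn.
- have [->|ij] := eqVneq i j; first by rewrite /= eqxx.
  by move=> h; have := slack_rank_lt t' ij; rewrite -h ltnn.
rewrite /=; case: (eqVneq j i) (eqVneq j' i) => [->|_] [->|_] //.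
by case=> /addnI/ord_inj/enum_rank_inj ->.
Qed.

Notation dom := (dominant slack_rank).
Notation rms := (rooms slack_rank).
Let D0 : {set T + I} := [set inr i | i in [set~ i0]].

Lemma card_D0 : #|D0|.+1 = #|I|.
Proof.
rewrite card_imset ?cardsC1 ?prednK // => [|? ? [] //].
by apply/card_gt0P; exists i0.
Qed.

(** For [i] other than [i0] the slack [inr i] has rank 0 in order [i], so a room through [D0] can
    dominate a point of [T] only in order [i0]. Its extra point must therefore be the [i0]-largest
    point of [T]. *)
Lemma card_rooms_D0 : #|rms D0| = 1.
Proof.
pose tm := [arg max_(t > t0) rk i0 t].
have tmP t : rk i0 t <= rk i0 tm by rewrite /tm; case: arg_maxnP => // ? _; apply.
rewrite (_ : rms D0 = [set inl tm |: D0]) ?cards1 //.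
apply/setP => U; rewrite in_set1; apply/(rooms_addP _ _ card_D0)/eqP.
  move=> [y yD [-> /dominantP dU]]; congr (_ |: _).
  have [i hi] := dU (inl tm).
  have ii0 : i = i0.
    apply/eqP/negPn/negP => ii0; have := hi (inr i).
    by rewrite in_setU1 imset_f ?orbT ?inE //= eqxx => /(_ isT).
  subst i; have := hi y; rewrite setU11 => /(_ isT).
  case: y yD {hi dU} => [t|j] yD /= h.
    by congr inl; apply/(rk_inj (i := i0))/eqP; rewrite eqn_leq tmP.
  have [ji|ji] := eqVneq j i0; first by move: h; rewrite ji eqxx.
  by move: yD; rewrite imset_f // !inE.
move=> ->; exists (inl tm); first by apply/imsetP => -[].
split=> //; apply/dominantP => -[t|j].
  exists i0 => x; rewrite in_setU1 => /predU1P[->|/imsetP[j]]; first exact: tmP.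
  by rewrite !inE => ji ->; apply/ltnW/slack_rank_lt; rewrite eq_sym.
by exists j => x _; rewrite /= eqxx.
Qed.

(** [D0] is the only boundary door. Any other door of these colours contains a point of [T], so
    [inr a] lies in [above a] for each [a]: the door has two rooms if it is dominant and none
    otherwise. *)
Lemma card_rooms_slack (D : {set T + I}) :
  #|D|.+1 = #|I| -> slack_colour @: D = [set~ i0] ->
  odd #|rms D| = (D == D0).
Proof.
move=> cD hc; have [->|DD0] := eqVneq D D0; first by rewrite card_rooms_D0.
have [domD|ndomD] := boolP (dom D); last first.
  rewrite (_ : rms D = set0) ?cards0 //; apply/setP => U; rewrite !inE.
  by apply/and3P => -[dU _ DU]; move/negP : ndomD; apply; exact: dominantS dU.
have [t tD] : exists t, inl t \in D.
  apply/existsP; apply: contraNT DD0 => /existsPn h.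
  rewrite eqEcard -ltnS card_D0 cD leqnn andbT; apply/subsetP => -[t|i] iD.
    by have := h t; rewrite iD.
  by apply: imset_f; rewrite -hc -[i]/(slack_colour (inr i)); exact: imset_f.
have D_neq0 : D != set0 by apply/set0Pn; exists (inl t).
have [mn mnP] := exists_rank_min slack_rank D_neq0.
rewrite (card_rooms_inner slack_rank_inj cD mnP domD) // => a.
exists (inr a); apply/aboveP => j ja.
apply: leq_ltn_trans ((mnP j).2 _ tD) _; exact: slack_rank_lt.
Qed.

Lemma sum_card_rel (A B : finType) (r : A -> B -> bool) :
  \sum_a #|[set b | r a b]| = \sum_b #|[set a | r a b]|.
Proof.
transitivity (\sum_a \sum_b (r a b : nat)).
  apply: eq_bigr => a _; rewrite -sum1dep_card big_mkcond.
  by apply: eq_bigr => b _; case: (r a b).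
rewrite exchange_big; apply: eq_bigr => b _.
by rewrite -sum1dep_card [RHS]big_mkcond; apply: eq_bigr => a _; case: (r a b).
Qed.

(** Count incidences of rooms with doors of all colours but [i0], modulo 2: on the side of the doors
    only [D0] contributes, on the side of the rooms only the rainbow ones. *)
Lemma exists_rainbow_room :
  exists U : {set T + I}, [/\ dom U, #|U| = #|I| & slack_colour @: U = setT].
Proof.
pose r (D U : {set T + I}) :=
  (U \in rms D) && (D \in almost_rainbow slack_colour i0 U).
have := congr1 odd (sum_card_rel r); rewrite !odd_sum.
rewrite (_ : [set D | _] = [set D0]) ?cards1 /=; last first.
  apply/setP => D; rewrite !inE.
  have [/eqP cD|cD] := boolP (#|D|.+1 == #|I|); last first.
    rewrite (_ : [set _ | _] = set0) ?cards0 /=; last first.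
      by apply/setP => U; rewrite /r !inE (negbTE cD) !andbF.
    by apply/esym/negbTE; apply: contraNneq cD => ->; rewrite card_D0.
  have [/eqP hc|hc] := boolP (slack_colour @: D == [set~ i0]); last first.
    rewrite (_ : [set _ | _] = set0) ?cards0 /=; last first.
      by apply/setP => U; rewrite /r !inE (negbTE hc) !andbF.
    apply/esym/negbTE; apply: contraNneq hc => ->.
    by rewrite -imset_comp imset_id.
  rewrite -(card_rooms_slack cD hc) (_ : [set _ | _] = rms D) //.
  apply/setP => U; rewrite /r !inE cD hc !eqxx /=.
  by case: (D \subset U); rewrite ?andbF ?andbT.
move=> /esym oU.
have [U] : exists U, U \in [set U | odd #|[set D | r D U]|].
  by apply/set0Pn; apply: contraTneq oU => ->; rewrite cards0.
rewrite inE => oDU.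
have [D] : exists D, D \in [set D | r D U].
  by apply/set0Pn; apply: contraTneq oDU => ->; rewrite cards0.
rewrite /r !inE => /andP[/and3P[dU /eqP cU _] _]; exists U; split=> //; apply/eqP.
rewrite -(odd_card_almost_rainbow slack_colour i0 cU).
rewrite (_ : almost_rainbow _ _ _ = [set D | r D U]) //.
apply/setP => D'; rewrite /r !inE dU cU eqxx /=.
by case: (D' \subset U).
Qed.

(** Remove the slack points from a rainbow room: [S] consists of its points in [T], and [C] of the
    indices whose slack is absent. An order whose slack is present cannot dominate a point of [T],
    as that slack has rank 0 there. *)
Lemma scarf : exists (S : {set T}) (C : {set I}),
  [/\ S != set0, c @: S = C &
      forall y, exists2 i, i \in C & forall x, x \in S -> rk i y <= rk i x].
Proof.
have [U [/dominantP dU cU hc]] := exists_rainbow_room.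
have cI : {in U &, injective slack_colour}.
  by apply/imset_injP; rewrite hc cardsT cU.
pose S := [set t | inl t \in U]; pose C := [set i | inr i \notin U].
have SC : c @: S = C.
  apply/setP => i; rewrite inE; apply/imsetP/idP => [[t]|iU].
    rewrite inE => tU ->; apply/negP => cU'.
    by have := cI (inl t) (inr (c t)) tU cU' erefl.
  have : i \in slack_colour @: U by rewrite hc inE.
  case/imsetP => -[t|j] pU ij; first by exists t; rewrite ?inE.
  by move: iU; rewrite ij pU.
have dS y : exists2 i, i \in C & forall x, x \in S -> rk i y <= rk i x.
  have [i hi] := dU (inl y); exists i.
    by rewrite inE; apply/negP => /hi; rewrite /= eqxx.
  by move=> x; rewrite inE => /hi.
exists S, C; split=> //.
have [i iC _] := dS t0.
by move: iC; rewrite -SC => /imsetP[t tS _]; apply/set0Pn; exists t.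
Qed.
End Scarf.

(** * Fractional matchings in partite hypergraphs *)

Local Open Scope ring_scope.

Lemma exists_sparse_kernel (F : fieldType) (X Y : finType) (E : {set X})
    (T : {set Y}) (a : Y -> X -> F) : (#|T| < #|E|)%N ->
  exists z : X -> F, [/\ exists x, z x != 0, forall x, x \notin E -> z x = 0 &
    forall y, y \in T -> \sum_x a y x * z x = 0].
Proof.
move=> TE.
pose A : 'M[F]_(#|E|, #|T|) := \matrix_(i, j) a (enum_val j) (enum_val i).
have : kermx A != 0.
  rewrite -mxrank_eq0 mxrank_ker subn_eq0 -ltnNge.
  exact: leq_ltn_trans (rank_leq_col A) TE.
case/rowV0Pn => u /sub_kermxP uA u0.
pose z x := \sum_(i | enum_val i == x) u 0 i.
have zE (i : 'I_#|E|) : z (enum_val i) = u 0 i.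
  rewrite /z (big_pred1 i) // => k /=.
  by apply/eqP/eqP => [/enum_val_inj|->].
exists z; split.
- have [i ui] : exists i, u 0 i != 0.
    apply/existsP; apply: contraNT u0 => /existsPn h.
    by apply/eqP/rowP => i; rewrite mxE; apply/eqP; have := h i; rewrite negbK.
  by exists (enum_val i); rewrite zE.
- move=> x xE; rewrite /z big1 // => i /eqP ix.
  by move: xE; rewrite -ix enum_valP.
move=> y yT; rewrite (bigID (mem E)) /= [X in _ + X]big1 ?addr0; last first.
  move=> x xE; rewrite /z big1 ?mulr0 // => i /eqP ix.
  by move: xE; rewrite -ix enum_valP.
rewrite big_enum_val /=; under eq_bigr do rewrite zE.
transitivity ((u *m A) 0 (enum_rank_in yT y)); last by rewrite uA mxE.
by rewrite mxE; apply: eq_bigr => i _; rewrite mxE enum_rankK_in // mulrC.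
Qed.

(** The ratio test of the simplex method: move along [d] until the first decreasing coordinate
    reaches 0. *)
Lemma exists_boundary_step (R : realFieldType) (K : finType) (c d : K -> R) :
  (forall k, 0 <= c k) -> (forall k, c k = 0 -> d k = 0) ->
  (exists k, d k < 0) ->
  exists t, [/\ 0 < t, forall k, 0 <= c k + t * d k &
    exists2 k, c k != 0 & c k + t * d k = 0].
Proof.
move=> c0 cd [k0 dk0].
have [k dk kmin] := @Order.TotalTheory.arg_minP _ _ _ k0 (fun k => d k < 0)
  (fun k => c k / - d k) dk0.
have ck : c k != 0 by apply: contraTneq dk => /cd ->; rewrite ltxx.
have ck0 : 0 < c k by rewrite lt_def ck c0.
exists (c k / - d k); split.
- by rewrite divr_gt0 // oppr_gt0.
- move=> j; have [dj|dj] := ltP (d j) 0; last first.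
    by rewrite addr_ge0 // mulr_ge0 // divr_ge0 // oppr_ge0 ltW.
  have := kmin j dj; rewrite ler_pdivlMr ?oppr_gt0 //; lra.
exists k => //; field; exact: ltr0_neq0.
Qed.

Section FractionalMatching.
Variables (R : realFieldType) (n r : nat).
Implicit Types (e f : edge n r) (w z : edge n r -> R).

Definition load w (p : 'I_r * 'I_n) : R := \sum_(e : edge n r | e p.1 == p.2) w e.

Definition fractional_matching w :=
  (forall e, 0 <= w e) /\ (forall p, load w p <= 1).

Definition meets e f := [exists l, e l == f l].

Definition tight w := [set p | load w p == 1].
Definition supp w := [set e | w e != 0].

Lemma sum_load l w : \sum_j load w (l, j) = \sum_e w e.
Proof. by rewrite (partition_big (fun e : edge n r => e l) xpredT). Qed.

Lemma disjoint_not_meets e f :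
  ~~ meets e f -> (edge_vertices e :&: edge_vertices f = set0)%SET.
Proof.
move=> /existsPn h; apply/setP => -[l j]; rewrite !inE.
apply/andP => -[/imsetP[k _ [-> ->]] /imsetP[k' _ [kk' ekk']]].
by have := h k; rewrite ekk' -kk' eqxx.
Qed.

(** The loads of the [r] vertices of [e] add up to at most [r]. They count each edge meeting [e] at
    least once and [e] itself [r] times, so the surplus [w e * (r - 1)], at least 1, can be
    subtracted. *)
Lemma sum_meets_heavy w e : (2 <= r)%N -> fractional_matching w ->
  1 <= w e * (r%:R - 1) -> \sum_(f | meets e f) w f <= r%:R - 1.
Proof.
move=> r2 [w0 w1] we.
have h : \sum_(f | meets e f) w f + w e * (r%:R - 1) <= \sum_l load w (l, e l).
  rewrite /load (exchange_big_dep xpredT) //= [X in _ <= X](bigD1 e) //=.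
  rewrite (bigD1 e) /=; last first.
    by apply/existsP; exists (Ordinal (ltnW r2)).
  rewrite [X in _ <= X + _](eq_bigl xpredT); last by move=> l; rewrite eqxx.
  rewrite sumr_const card_ord -[w e *+ r]mulr_natr addrAC.
  have -> : w e * r%:R = w e + w e * (r%:R - 1) by ring.
  rewrite lerD2l big_mkcond [X in _ <= X]big_mkcond /=.
  apply: ler_sum => f _; case: ifP => [/andP[/existsP[l el] ->]|_].
    rewrite (bigD1 l) /=; last by rewrite eq_sym.
    by rewrite lerDl sumr_ge0.
  by case: ifP => // _; rewrite sumr_ge0.
have := le_trans h (ler_sum _ (fun l _ => w1 (l, e l))).
by rewrite sumr_const card_ord; lra.
Qed.

(** All weights are below [1 / (r - 1)], so a tight vertex lies on at least [r] support edges, while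
    an edge has only [r] vertices. Counting incidences both ways gives the bound; equality forces
    every vertex of a support edge to be tight. *)
Lemma card_tight_le_supp w : (2 <= r)%N -> fractional_matching w ->
  (forall e, w e * (r%:R - 1) < 1) ->
  (#|tight w| <= #|supp w|)%N /\
  (#|tight w| = #|supp w| -> forall e l, e \in supp w -> (l, e l) \in tight w).
Proof.
move=> r2 [w0 w1] light.
have deg p : p \in tight w -> (r <= #|[set e in supp w | e p.1 == p.2]|)%N.
  rewrite inE => /eqP p1; set D := [set _ | _].
  have r1 : 0 < r%:R - 1 :> R by rewrite subr_gt0 ltr1n.
  have wD : load w p = \sum_(e in D) w e.
    rewrite /load big_mkcond [RHS]big_mkcond; apply: eq_bigr => e _.
    by rewrite !inE; case: (eqVneq (w e) 0) => [->|]; case: ifP.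
  have [D0|[e0 e0D]] := set_0Vmem D.
    by move: p1; rewrite wD D0 big_set0 => /eqP; rewrite eq_sym oner_eq0.
  have : \sum_(e in D) w e * (r%:R - 1) < \sum_(e in D) 1.
    apply: ltr_sum; first by apply/hasP; exists e0; rewrite ?mem_index_enum.
    by move=> e _; exact: light.
  rewrite -mulr_suml -wD p1 mul1r sumr_const ltrBlDr -[X in _ < _ + X]/(1%:R).
  by rewrite -natrD ltr_nat addn1 ltnS.
have cnt : (\sum_(p in tight w) #|[set e in supp w | e p.1 == p.2]| =
    \sum_(e in supp w) #|[set l | (l, e l) \in tight w]|)%N.
  under eq_bigr do rewrite -sum1dep_card big_mkcondr /=.
  under [RHS]eq_bigr do rewrite -sum1dep_card big_mkcond /=.
  rewrite exchange_big /=; apply: eq_bigr => e _.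
  rewrite -big_mkcondr /= -[RHS]big_mkcond /=.
  rewrite !sum1dep_card -(card_imset _ (f := fun l => (l, e l))); last by move=> ? ? [].
  apply: eq_card => -[l j]; rewrite !inE /=; apply/andP/imsetP.
    by move=> [lj /eqP ej]; exists l; rewrite ?inE ej.
  by move=> [k]; rewrite !inE => kt [-> ->].
have low : (r * #|tight w| <=
    \sum_(e in supp w) #|[set l | (l, e l) \in tight w]|)%N.
  by rewrite -cnt mulnC -sum_nat_const leq_sum.
have cr e : (#|[set l | (l, e l) \in tight w]| <= r)%N.
  by rewrite -[X in (_ <= X)%N]card_ord max_card.
have r0 : (0 < r)%N by exact: ltnW.
split.
  rewrite -(leq_pmul2l r0); apply: leq_trans low _.
  by rewrite mulnC -sum_nat_const leq_sum.
move=> cE e l eE; move: low; rewrite cE (bigD1 e) //= (cardD1 e) eE mulnDr muln1.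
move=> low.
have hi : (\sum_(f in supp w | f != e) #|[set l | (l, f l) \in tight w]| <=
    r * #|[predD1 supp w & e]|)%N.
  rewrite mulnC -sum_nat_const (eq_bigl [in [predD1 supp w & e]]).
    by apply: leq_sum => f _; exact: cr.
  by move=> f; rewrite !inE andbC.
have re : (r <= #|[set l | (l, e l) \in tight w]|)%N.
  by have := leq_trans low (leq_add (leqnn _) hi); rewrite leq_add2r.
have : [set l | (l, e l) \in tight w] == [set: 'I_r].
  by rewrite eqEcard subsetT cardsT card_ord.
by move/eqP/setP/(_ l); rewrite !inE.
Qed.

(** A homogeneous system with one unknown per support edge and one equation per tight vertex; the
    incidence count leaves a nonzero solution. *)
Lemma exists_tight_direction w : (2 <= r)%N -> fractional_matching w ->
  (exists e, w e != 0) -> (forall e, w e * (r%:R - 1) < 1) ->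
  exists z, [/\ exists e, z e != 0, forall e, w e = 0 -> z e = 0 &
    forall p, p \in tight w -> load z p = 0].
Proof.
move=> r2 wm [e0 we0] light.
have [leTE eqTE] := card_tight_le_supp r2 wm light.
have loadE z p : load z p = \sum_(e : edge n r) (e p.1 == p.2)%:R * z e.
  rewrite /load big_mkcond; apply: eq_bigr => e _.
  by case: eqP; rewrite ?mul1r ?mul0r.
have suppE e z : (forall x, x \notin supp w -> z x = 0) -> w e = 0 -> z e = 0.
  by move=> h we; apply: h; rewrite inE we eqxx.
move: leTE; rewrite leq_eqVlt => /predU1P[cTE|ltTE]; last first.
  have [z [z0 zs zT]] := @exists_sparse_kernel R _ _ (supp w) (tight w)
    (fun p (e : edge n r) => (e p.1 == p.2)%:R) ltTE.
  exists z; split=> // [e|p /zT]; [exact: suppE|by rewrite loadE].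
have allT := eqTE cTE.
(* The tight constraints are dependent, since those of any two parts have the
   same sum on [supp w]: one of them may be dropped. *)
pose l0 : 'I_r := Ordinal (ltnW r2); pose l1 : 'I_r := Ordinal r2.
have e0s : e0 \in supp w by rewrite inE.
pose p0 := (l0, e0 l0).
have ltTE : (#|tight w :\ p0| < #|supp w|)%N.
  by rewrite -cTE (cardsD1 p0 (tight w)) allT.
have [z [z0 zs zT]] := @exists_sparse_kernel R _ _ (supp w) (tight w :\ p0)
    (fun p (e : edge n r) => (e p.1 == p.2)%:R) ltTE.
have zT' p : p \in tight w -> p != p0 -> load z p = 0.
  by move=> pT pp0; rewrite loadE zT // in_setD1 pp0.
have zn p : p \notin tight w -> load z p = 0.
  move=> pT; rewrite /load big1 // => e /eqP ep.
  apply/eqP/negPn/negP => ze; move/negP : pT; apply.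
  have -> : p = (p.1, e p.1) by rewrite ep; case: (p).
  by apply: allT; apply: contraNT ze => /zs ->.
have zp0 : load z p0 = 0.
  transitivity (\sum_j load z (l0, j)).
    rewrite (bigD1 (e0 l0)) //= big1 ?addr0 // => j je.
    have [?|/zn //] := boolP ((l0, j) \in tight w).
    by apply: zT' => //; rewrite xpair_eqE eqxx.
  rewrite sum_load -(sum_load l1) big1 // => j _.
  have [?|/zn //] := boolP ((l1, j) \in tight w).
  by apply: zT' => //; rewrite xpair_eqE.
exists z; split=> // [e|p pT]; first exact: suppE.
by have [->|] := eqVneq p p0; last exact: zT'.
Qed.

Lemma load_comb w z t p :
  load (fun e => w e + t * z e) p = load w p + t * load z p.
Proof. by rewrite /load big_split -mulr_sumr. Qed.

(** One coordinate for each inequality defining the polytope of fractional matchings, so that a step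
    to its boundary is a case of [exists_boundary_step]. *)
Definition slack w (k : edge n r + 'I_r * 'I_n) : R :=
  match k with inl e => w e | inr p => 1 - load w p end.

Lemma fractional_matching_slack w :
  fractional_matching w <-> forall k, 0 <= slack w k.
Proof.
split=> [[w0 w1] [e|p] |h]; [exact: w0|by rewrite /= subr_ge0|].
by split=> [e|p]; [exact: (h (inl e))|rewrite -subr_ge0; exact: (h (inr p))].
Qed.

(** While all edges are light, some direction preserves every tight constraint; its sign is chosen
    so that the total weight does not drop. Moving along it to the boundary lowers the number of
    nonzero slacks, so the process ends at a heavy edge. *)
Lemma exists_heavy_edge w : (2 <= r)%N -> fractional_matching w ->
  (exists e, w e != 0) ->
  exists w', [/\ fractional_matching w', supp w' \subset supp w,
    \sum_e w e <= \sum_e w' e & exists e, 1 <= w' e * (r%:R - 1)].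
Proof.
move=> r2.
have [N] := ubnP #|[set k | slack w k != 0]|.
elim: N w => // N IHN w; rewrite ltnS => leN wm wn0.
have [/existsP[e he]|] := boolP [exists e, 1 <= w e * (r%:R - 1)].
  by exists w; split=> //; exists e.
move=> /existsPn light.
have {}light e : w e * (r%:R - 1) < 1 by rewrite ltNge.
have [z [z0 zs zT]] : exists z, [/\ exists e, z e != 0,
    forall e, w e = 0 -> z e = 0, forall p, p \in tight w -> load z p = 0 &
    0 <= \sum_e z e].
  have [z [[e ze] zs zT]] := exists_tight_direction r2 wm wn0 light.
  have [sz|sz] := leP 0 (\sum_e z e); first by exists z; split=> //; exists e.
  exists (fun e => - z e); split=> [|e0 /zs ->|p /zT lz|]; rewrite ?oppr0 //.
  - by exists e; rewrite oppr_eq0.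
  - by rewrite /load sumrN -[X in - X]/(load z p) lz oppr0.
  by rewrite sumrN oppr_ge0 ltW.
move=> sz.
pose d (k : edge n r + 'I_r * 'I_n) : R :=
  match k with inl e => z e | inr p => - load z p end.
have slackE t k : slack (fun e => w e + t * z e) k = slack w k + t * d k.
  by case: k => [//|p] /=; rewrite load_comb; ring.
(* Either some weight decreases, or [z] is nonnegative and nonzero and then some load increases. *)
have dneg : exists k, d k < 0.
  have [/existsP[e ze]|/existsPn zge] := boolP [exists e, z e < 0].
    by exists (inl e).
  case: z0 => e ze; exists (inr (Ordinal (ltnW r2), e (Ordinal (ltnW r2)))).
  rewrite /= oppr_lt0 /load (bigD1 e) //= ltr_pwDl //.
    by rewrite lt_def ze leNgt zge.
  by apply: sumr_ge0 => f _; rewrite leNgt zge.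
have cd k : slack w k = 0 -> d k = 0.
  case: k => [e|p] /=; first exact: zs.
  by move=> /eqP; rewrite subr_eq0 eq_sym => p1; rewrite zT ?oppr0 // inE.
have [t [t0 tge [k ck tk]]] :=
  exists_boundary_step ((fractional_matching_slack w).1 wm) cd dneg.
pose w1 e := w e + t * z e.
have w1m : fractional_matching w1.
  by apply/fractional_matching_slack => j; rewrite slackE.
have s1 : \sum_e w e <= \sum_e w1 e.
  by rewrite big_split /= lerDl -mulr_sumr mulr_ge0 // ltW.
have sub1 : supp w1 \subset supp w.
  apply/subsetP => e; rewrite !inE; apply: contraNneq => we.
  by rewrite /w1 we zs // mulr0 addr0.
have w1n0 : exists e, w1 e != 0.
  apply/existsP; apply: contraT => /existsPn h.
  have : 0 < \sum_e w1 e.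
    case: wn0 => e we; apply: lt_le_trans s1.
    rewrite (bigD1 e) //= ltr_pwDl ?sumr_ge0 // => [|f _]; last exact: wm.1.
    by rewrite lt_def we wm.1.
  rewrite big1 ?ltxx // => e _; apply/eqP; have := h e; by rewrite negbK.
have [|w' [w'm sub' s' heavy]] := IHN w1 _ w1m w1n0.
  apply: leq_trans leN; apply: proper_card; apply/properP; split.
    apply/subsetP => j; rewrite !inE slackE; apply: contraNneq => cj.
    by rewrite cj cd // mulr0 addr0.
  by exists k; rewrite !inE ?slackE ?tk ?eqxx.
exists w'; split=> //; first exact: fintype.subset_trans sub' sub1.
exact: le_trans s1 s'.
Qed.

(** Greedy choice: take a heavy edge [e] and erase all edges meeting it, which costs at most [r - 1]
    of the total weight, then continue on the smaller support. *)
Theorem partite_furedi w : (2 <= r)%N -> fractional_matching w ->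
  exists M : {set edge n r}, [/\ is_matching M, M \subset supp w &
    \sum_e w e <= (r%:R - 1) * #|M|%:R].
Proof.
move=> r2; have [N] := ubnP #|supp w|; elim: N w => // N IHN w; rewrite ltnS.
move=> leN wm.
have [/existsP wn0|/existsPn w0] := boolP [exists e, w e != 0]; last first.
  exists set0; split; [by move=> e f; rewrite inE|exact: sub0set|].
  rewrite cards0 mulr0 big1 // => e _; by apply/eqP; have := w0 e; rewrite negbK.
have [w1 [w1m sub1 s1 [e he]]] := exists_heavy_edge r2 wm wn0.
have me := sum_meets_heavy r2 w1m he.
pose w2 f := if meets e f then 0 else w1 f.
have we : w1 e != 0.
  by apply: contraTneq he => ->; rewrite mul0r ler10.
have mee : meets e e by apply/existsP; exists (Ordinal (ltnW r2)).
have w2m : fractional_matching w2.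
  split=> [f|p]; first by rewrite /w2; case: ifP => // _; exact: w1m.1.
  apply: le_trans (w1m.2 p); apply: ler_sum => f _.
  by rewrite /w2; case: ifP => // _; exact: w1m.1.
have sub2 : supp w2 \subset supp w1.
  by apply/subsetP => f; rewrite !inE /w2; case: ifP; rewrite ?eqxx.
have [|M [Mm subM sM]] := IHN w2 _ w2m.
  apply: leq_trans leN; apply: leq_trans (subset_leq_card sub1).
  apply: proper_card; apply/properP; split=> //.
  by exists e; rewrite !inE ?/w2 ?mee ?eqxx // /w2 mee eqxx.
have nM f : f \in M -> ~~ meets e f.
  move/(subsetP subM); rewrite inE /w2; case: ifP => //.
  by rewrite eqxx.
exists (e |: M); split.
- move=> f g; rewrite !in_setU1 => /predU1P[->|fM] /predU1P[->|gM] fg.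
  + by rewrite eqxx in fg.
  + exact/disjoint_not_meets/nM.
  + by rewrite setIC; exact/disjoint_not_meets/nM.
  exact: Mm.
- rewrite subUset sub1set (subsetP sub1) ?inE //=.
  exact: fintype.subset_trans subM (fintype.subset_trans sub2 sub1).
rewrite cardsU1; case: (boolP (e \in M)) => [/nM|_]; first by rewrite mee.
rewrite natrD mulrDr mulr1; apply: le_trans s1 _.
rewrite (bigID (meets e)) /=; apply: lerD => //.
apply: le_trans sM; rewrite big_mkcond; apply: ler_sum => f _.
by rewrite /w2; case: (meets e f).
Qed.

End FractionalMatching.

(** * Closed covers of a simplex *)

From mathcomp Require Import all_classical all_reals all_analysis.
Import numFieldNormedType.Exports.
Local Open Scope classical_set_scope.

Definition std_simplex (R : realType) (I : finType) : set (I -> R) :=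
  [set x | (forall i, 0 <= x i) /\ \sum_i x i = 1].
Arguments std_simplex : clear implicits.

Section GridSperner.
Variables (I : finType) (i0 : I) (m : nat).

Definition grid := {x : {ffun I -> 'I_m.+1} | (\sum_i x i)%N == m}.
HB.instance Definition _ := Finite.on grid.

Implicit Types x y : grid.

Definition grid_coord x i : nat := val x i.
Local Notation g := grid_coord.

Lemma sum_grid_coord x : (\sum_i g x i = m)%N.
Proof. by apply/eqP; exact: (valP x). Qed.

Lemma exists_grid (y : I -> nat) : (\sum_i y i = m)%N ->
  exists x, forall i, g x i = y i.
Proof.
move=> ym.
have yle i : (y i < m.+1)%N by rewrite ltnS -ym (bigD1 i) //= leq_addr.
have hs : (\sum_i [ffun i => Ordinal (yle i)] i)%N == m.
  by apply/eqP; rewrite -[RHS]ym; apply: eq_bigr => i _; rewrite ffunE.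
exists (exist (fun x : {ffun I -> 'I_m.+1} => (\sum_i x i)%N == m) _ hs) => i.
by rewrite /g /grid_coord /= ffunE.
Qed.

(** Compares the [i]-th coordinates and breaks ties by the enumeration of the grid, since Scarf's
    lemma asks for injective ranks. *)
Definition grid_rank (i : I) x : nat := (g x i * #|{: grid}| + enum_rank x)%N.

Lemma grid_rank_inj i : injective (grid_rank i).
Proof.
move=> x y; have lx := ltn_ord (enum_rank x); have ly := ltn_ord (enum_rank y).
move/(congr1 (modn^~ #|{: grid}|)).
by rewrite !modnMDl !modn_small // => /ord_inj/enum_rank_inj.
Qed.

Lemma grid_rank_lt i x y : (g x i < g y i)%N -> (grid_rank i x < grid_rank i y)%N.
Proof.
move=> h; have lx := ltn_ord (enum_rank x); rewrite /grid_rank.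
apply: (@leq_trans ((g x i).+1 * #|{: grid}|)).
  by rewrite mulSn [X in (_ < X)%N]addnC ltn_add2l.
by apply: leq_trans (leq_addr _ _); rewrite leq_mul2r h orbT.
Qed.

(** Let [a i] be the least [i]-th coordinate on Scarf's set [S]. Dominance makes the sum of [a] over
    [C] exceed [m - #|C|], so on [S] the coordinates in [C] stay within [#|I|] of [a] and the others
    are at most [#|I|]. Any point of [S] then serves as [z]. *)
Lemma grid_sperner (c : grid -> I) : exists z : grid, forall i,
  (g z i <= #|I|)%N \/ exists2 x : grid, c x = i &
    forall j, (g x j <= g z j + #|I|)%N /\ (g z j <= g x j + #|I|)%N.
Proof.
have [t0 _] : exists t0 : grid, forall i, g t0 i = if i == i0 then m else 0%N.
  apply: exists_grid; rewrite (bigD1 i0) //= eqxx big1 ?addn0 // => i ii0.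
  by rewrite (negbTE ii0).
have [S [C [/set0Pn[z zS] cS dom]]] := scarf t0 i0 c grid_rank_inj.
pose a i := g [arg min_(x < z in S) g x i]%N i.
have aP i x : x \in S -> (a i <= g x i)%N.
  by rewrite /a; case: arg_minnP => // y _ h /h.
have aE i : exists2 x, x \in S & g x i = a i.
  by rewrite /a; case: arg_minnP => // y yS _; exists y.
(* Otherwise some grid point has coordinate at least [a i + 1] for every [i] in [C], the remaining
   mass being put on [i0]; it contradicts dominance. *)
have big_a : (m < \sum_(i in C) (a i).+1)%N.
  rewrite ltnNge; apply/negP => le_m.
  pose yy i := ((if i \in C then (a i).+1 else 0) +
    (if i == i0 then m - \sum_(i in C) (a i).+1 else 0))%N.
  have [|y yE] := @exists_grid yy.
    rewrite big_split /= -!big_mkcond /= big_pred1_eq subnKC //.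
  have [i iC hi] := dom y; have [x xS xa] := aE i.
  have := hi x xS; rewrite leqNgt grid_rank_lt // yE /yy iC xa.
  by rewrite leq_addr.
have cC : (#|C| <= #|I|)%N by exact: max_card.
have big_a' : (m < \sum_(i in C) a i + #|C|)%N.
  move: big_a; under eq_bigr do rewrite -addn1.
  by rewrite big_split /= sum1_card.
have out x i : x \in S -> i \notin C -> (g x i <= #|I|)%N.
  move=> xS iC.
  have : (g x i + \sum_(j in C) g x j <= m)%N.
    rewrite -[X in (_ <= X)%N](sum_grid_coord x).
    rewrite [X in (_ <= X)%N](bigD1 i) //= leq_add2l.
    rewrite [X in (X <= _)%N]big_mkcond [X in (_ <= X)%N]big_mkcond.
    apply: leq_sum => j _.
    by case: (eqVneq j i) => [->|_]; [rewrite (negbTE iC)|case: ifP].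
  have : (\sum_(j in C) a j <= \sum_(j in C) g x j)%N.
    by apply: leq_sum => j _; exact: aP.
  by lia.
have inC x i : x \in S -> i \in C -> (g x i <= a i + #|I|)%N.
  move=> xS iC.
  have : (\sum_(j in C) g x j <= m)%N.
    rewrite -[X in (_ <= X)%N](sum_grid_coord x) big_mkcond leq_sum // => j _.
    by case: ifP.
  have : (\sum_(j in C | j != i) a j <= \sum_(j in C | j != i) g x j)%N.
    by apply: leq_sum => j _; exact: aP.
  have := big_a'; rewrite (bigD1 i) //=.
  rewrite [X in _ -> _ -> (X <= m)%N -> _](bigD1 i) //=.
  have key p q g q' k k' : (m < p + q + k -> q <= q' -> g + q' <= m ->
    k <= k' -> g <= p + k')%N by lia.
  by move=> h1 h2 h3; exact: key h1 h2 h3 cC.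
have close x y i : x \in S -> y \in S -> (g x i <= g y i + #|I|)%N.
  move=> xS yS; have [iC|iC] := boolP (i \in C).
    by apply: leq_trans (inC _ _ xS iC) _; rewrite leq_add2r aP.
  by apply: leq_trans (out _ _ xS iC) (leq_addl _ _).
exists z => i; have [iC|iC] := boolP (i \in C); last by left; exact: out.
right; move: iC; rewrite -cS => /imsetP[x xS ->].
by exists x => // j; rewrite !close.
Qed.

End GridSperner.

(** * Limits of grid points *)

Section KKM.
Variables (R : realType) (I : finType).
Implicit Types (x z : I -> R) (u : nat -> I -> R).
Local Notation S := (std_simplex R I).

Lemma std_simplex_le1 x i : S x -> x i <= 1.
Proof. by move=> [x0 <-]; rewrite (bigD1 i) //= lerDl sumr_ge0. Qed.

Lemma approximate_kkm_dual (i0 : I) (F : I -> set (I -> R)) (m : nat) :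
  (0 < m)%N -> (forall x, S x -> exists i, F i x) ->
  exists2 z, S z & forall i, z i <= #|I|%:R / m%:R \/
    exists x, [/\ S x, F i x & forall j, `|x j - z j| <= #|I|%:R / m%:R].
Proof.
move=> m0 cov; have mR : 0 < m%:R :> R by rewrite ltr0n.
pose pt (x : grid I m) i : R := (grid_coord x i)%:R / m%:R.
have ptS (x : grid I m) : S (pt x).
  split=> [i|]; first by rewrite /pt divr_ge0.
  rewrite /pt -mulr_suml -natr_sum sum_grid_coord mulfV //; exact: lt0r_neq0.
have [c cP] := choice (fun x : grid I m => cov _ (ptS x)).
have [z hz] := @grid_sperner I i0 m c; exists (pt z) => // i.
have [le_z|[x <- hx]] := hz i; [left|right].
  by rewrite ler_pM2r ?invr_gt0 // ler_nat.
exists (pt x); split=> // j; rewrite -mulrBl normrM [`|_^-1|]ger0_norm ?invr_ge0 //.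
rewrite ler_pM2r ?invr_gt0 // ler_norml; have [h1 h2] := hx j.
apply/andP; split; last by rewrite lerBlDr -natrD ler_nat addnC.
by rewrite lerBrDl lerBlDr -natrD ler_nat.
Qed.

Lemma increasing_subseq_cvg (f : nat -> nat) (v : nat -> R) (l : R) :
  increasing_seq f -> v @ \oo --> l -> (v \o f) @ \oo --> l.
Proof.
move=> fi vl; apply: cvg_comp vl; apply/cvgnyPge => N.
exists N => // k /= Nk; apply: leq_trans Nk _.
elim: k => // k IH; apply: leq_ltn_trans IH _.
by rewrite ltnNge -leEnat fi ltnn.
Qed.

Lemma pointwise_bolzano_weierstrass u :
  (forall k i, `|u k i| <= 1) ->
  exists2 f : nat -> nat, increasing_seq f &
  exists l : I -> R, forall i, (fun k => u (f k) i) @ \oo --> l i.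
Proof.
move=> u1.
suff [f fi fc] : exists2 f : nat -> nat, increasing_seq f &
    forall i, i \in enum I -> cvgn (fun k => u (f k) i).
  by exists f => //; exists (fun i => limn (fun k => u (f k) i)) => i;
    apply: fc; rewrite mem_enum.
elim: (enum I) => [|i s [f fi fc]]; first by exists id.
have [|h hi hc] := @bolzano_weierstrass R (fun k => u (f k) i).
  exists 1; split=> // M M1 k _; exact: le_trans (u1 _ _) (ltW M1).
exists (f \o h) => [n k|j]; first by rewrite /= fi -leEnat hi.
rewrite inE => /predU1P[->//|/fc/cvg_ex[l hl]].
by apply/cvg_ex; exists l; exact: (increasing_subseq_cvg hi hl).
Qed.

Lemma cvgn_sum (J : finType) (P : pred J) (u : J -> nat -> R) (l : J -> R) :
  (forall j, P j -> u j @ \oo --> l j) ->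
  (fun k => \sum_(j | P j) u j k) @ \oo --> \sum_(j | P j) l j.
Proof. by move=> h; apply: cvg_big => //; exact: add_continuous. Qed.

Lemma std_simplex_cvg u l : (forall k, S (u k)) ->
  (forall i, (fun k => u k i) @ \oo --> l i) -> S l.
Proof.
move=> uS ul; split=> [i|].
  by apply: (cvgr_to_ge (ul i)); apply: nearW => k; exact: (uS k).1.
have h := cvgn_sum (P := xpredT) (fun i _ => ul i).
have u1 : (fun k => \sum_i u k i) = fun=> 1 by apply/funext => k; exact: (uS k).2.
by apply: (cvg_unique _ h) => //; rewrite u1; exact: cvg_cst.
Qed.

(* The labelling version of Sperner's lemma with no boundary condition: a
   coordinate either vanishes at the limit or its label occurs there. *)
Lemma kkm_dual (i0 : I) (F : I -> set (I -> R)) :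
  (forall x, S x -> exists i, F i x) ->
  (forall i u l, (forall k, S (u k) /\ F i (u k)) ->
     (forall j, (fun k => u k j) @ \oo --> l j) -> F i l) ->
  exists2 z, S z & forall i, z i = 0 \/ F i z.
Proof.
move=> cov clo.
pose e (k : nat) : R := #|I|%:R / k.+1%:R.
have e0 : e @ \oo --> (0 : R).
  rewrite -[X in _ --> X](mulr0 #|I|%:R); apply: cvgM; first exact: cvg_cst.
  exact: cvg_harmonic.
have /choice[u uP] : forall k, exists z, S z /\ forall i, z i <= e k \/
    exists x, [/\ S x, F i x & forall j, `|x j - z j| <= e k].
  by move=> k; have [z] := approximate_kkm_dual i0 (ltn0Sn k) cov; exists z.
have [|f fi [l ul]] := @pointwise_bolzano_weierstrass u.
  move=> k i; rewrite ger0_norm ?(uP k).1.1 //.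
  exact: std_simplex_le1 (uP k).1.
have Sl : S l by apply: (std_simplex_cvg _ ul) => k; exact: (uP _).1.
have ef0 : (e \o f) @ \oo --> (0 : R) := increasing_subseq_cvg fi e0.
exists l => // i.
have [->|li] := eqVneq (l i) 0; [by left|right].
have li0 : 0 < l i by rewrite lt_def li Sl.1.
(* As [l i] is positive and [e] tends to 0, the first alternative of [uP] fails from some index on;
   the second then yields points of [F i] converging to [l]. *)
have : \forall k \near \oo, e (f k) < u (f k) i.
  have h : (fun k => u (f k) i - e (f k)) @ \oo --> l i - 0.
    exact: cvgB (ul i) ef0.
  rewrite subr0 in h.
  near=> k; rewrite -subr_gt0; near: k; exact: (cvgr_gt _ h).
move=> [N _ hN].
have /choice[x xP] : forall k, exists x, [/\ S x, F i x &
    forall j, `|x j - u (f (k + N)%N) j| <= e (f (k + N)%N)].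
  move=> k; have [le_e|//] := (uP (f (k + N)%N)).2 i.
  have := hN (k + N)%N; rewrite /= leq_addl => /(_ isT).
  by rewrite ltNge le_e.
apply: (clo i x) => [k|j]; first by have [] := xP k.
have uN := cvg_comp _ _ (cvg_addnr N) (ul j).
have eN := cvg_comp _ _ (cvg_addnr N) ef0.
apply: (@squeeze_cvgr _ _ _ _ (fun k => u (f (k + N)%N) j - e (f (k + N)%N))
  (fun k => u (f (k + N)%N) j + e (f (k + N)%N))).
- near=> k; have [_ _ /(_ j)] := xP k.
  by rewrite ler_norml; lra.
- by rewrite -[l j]subr0; exact: cvgB uN eN.
by rewrite -[l j]addr0; exact: cvgD uN eN.
Unshelve. all: by end_near. Qed.

End KKM.

(** * Bump functions *)

Section Bump.
Variables (R : realType) (I : finType).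
Implicit Types (x y b : I -> R) (B : set (I -> R)) (u : nat -> I -> R).

Definition l1dist x y : R := \sum_i `|x i - y i|.

Lemma l1dist_ge0 x y : 0 <= l1dist x y.
Proof. exact: sumr_ge0. Qed.

Lemma l1dist_self x : l1dist x x = 0.
Proof. by apply: big1 => i _; rewrite subrr normr0. Qed.

Lemma l1dist_sym x y : l1dist x y = l1dist y x.
Proof. by apply: eq_bigr => i _; rewrite distrC. Qed.

Lemma l1dist_triangle y x z : l1dist x z <= l1dist x y + l1dist y z.
Proof. by rewrite -big_split; apply: ler_sum => i _; exact: ler_distD. Qed.

Lemma l1dist_cvg u (l : I -> R) : (forall i, (fun k => u k i) @ \oo --> l i) ->
  (fun k => l1dist (u k) l) @ \oo --> (0 : R).
Proof.
move=> ul.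
rewrite -(l1dist_self l).
apply: (cvgn_sum (P := xpredT)) => i _.
by apply: cvg_norm; apply: cvgB (ul i) _; exact: cvg_cst.
Qed.

Definition near_set B (d : R) : set (I -> R) :=
  [set x | exists2 b, B b & l1dist x b < d].

(** This is the positive part of [d - dist(x, B)]; adjoining 0 to the set also gives the value 0 for
    empty [B]. *)
Definition bump B (d : R) x : R :=
  sup ([set 0] `|` [set d - l1dist x b | b in B]).

Section BumpTheory.
Variables (B : set (I -> R)) (d : R).
Hypothesis d0 : 0 < d.

Lemma bump_has_sup x : has_sup ([set 0] `|` [set d - l1dist x b | b in B]).
Proof.
split; first by exists 0; left.
by exists d => _ [->|[b _ <-]]; [exact: ltW|rewrite gerBl l1dist_ge0].
Qed.

Lemma bump_ge0 x : 0 <= bump B d x.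
Proof. by apply: sup_upper_bound; [exact: bump_has_sup|left]. Qed.

Lemma bump_neq0 x : bump B d x != 0 <-> near_set B d x.
Proof.
split=> [b0|[b Bb xb]].
  have {b0} : 0 < bump B d x by rewrite lt_def b0 bump_ge0.
  move=> b0; have [_ [->|[b Bb <-]]] := sup_adherent b0 (bump_has_sup x).
    by rewrite subrr ltxx.
  by rewrite subrr subr_gt0 => ?; exists b.
apply: lt0r_neq0; apply: (@lt_le_trans _ _ (d - l1dist x b)).
  by rewrite subr_gt0.
by apply: sup_upper_bound; [exact: bump_has_sup|right; exists b].
Qed.

Lemma bump_lipschitz x y : bump B d x <= bump B d y + l1dist x y.
Proof.
apply: ge_sup; first by exists 0; left.
move=> _ [->|[b Bb <-]]; first by rewrite addr_ge0 ?bump_ge0 ?l1dist_ge0.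
have : d - l1dist y b <= bump B d y.
  by apply: sup_upper_bound; [exact: bump_has_sup|right; exists b].
by have := l1dist_triangle x y b; rewrite (l1dist_sym y x); lra.
Qed.

Lemma bump_cvg u (l : I -> R) : (forall i, (fun k => u k i) @ \oo --> l i) ->
  (fun k => bump B d (u k)) @ \oo --> bump B d l.
Proof.
move=> /l1dist_cvg ul.
apply: (@squeeze_cvgr _ _ _ _ (fun k => bump B d l - l1dist (u k) l)
  (fun k => bump B d l + l1dist (u k) l)).
- near=> k; rewrite bump_lipschitz andbT lerBlDr (l1dist_sym _ l).
  exact: bump_lipschitz.
- by rewrite -[X in _ --> X]subr0; apply: cvgB ul; exact: cvg_cst.
by rewrite -[X in _ --> X]addr0; apply: cvgD ul; exact: cvg_cst.
Unshelve. all: by end_near. Qed.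

End BumpTheory.
End Bump.

(** * A point with balanced marginals *)

Section BalancedPoint.
Variables (R : realType) (n r : nat).
Hypotheses (n1 : (1 <= n)%N) (r2 : (2 <= r)%N).
Implicit Types (x y : 'I_r * 'I_n -> R) (e : edge n r).

Definition simplex_power : set ('I_r * 'I_n -> R) :=
  [set x | (forall p, 0 <= x p) /\ forall l, \sum_j x (l, j) = 1].

Definition block_sum y l : R := \sum_j y (l, j).

(* On points whose blocks all have sum [1 / r], this is the homothety onto
   [simplex_power]. *)
Definition block_retraction y p : R :=
  (r%:R * y p + Num.max 0 (1 - r%:R * block_sum y p.1) / n%:R) /
  Num.max 1 (r%:R * block_sum y p.1).

Let nR : 0 < n%:R :> R. Proof. by rewrite ltr0n. Qed.
Let rR : 0 < r%:R :> R. Proof. by rewrite ltr0n ltnW. Qed.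

(** A block whose scaled sum is at most 1 is filled up evenly over its [n] coordinates; a block of
    larger scaled sum is divided by it. *)
Lemma block_retraction_simplex_power y :
  (forall p, 0 <= y p) -> simplex_power (block_retraction y).
Proof.
move=> y0; split=> [p|l].
  apply: divr_ge0; last by rewrite le_max ler01.
  apply: addr_ge0; first by rewrite mulr_ge0 // ltW.
  by rewrite divr_ge0 ?le_max ?lexx // ltW.
rewrite /block_retraction /= -mulr_suml big_split /= -mulr_sumr -/(block_sum y l).
rewrite sumr_const card_ord.
rewrite -[_ / _ *+ _]mulr_natr mulfVK ?lt0r_neq0 //.
set s := r%:R * _; case: (leP s 1) => s1.
  by rewrite max_r ?subr_ge0 // divr1; ring.
by rewrite max_l ?subr_le0 ?ltW // addr0 mulfV // lt0r_neq0 // (lt_trans ltr01).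
Qed.

Lemma block_retraction_homothety y p :
  r%:R * block_sum y p.1 = 1 -> block_retraction y p = r%:R * y p.
Proof.
by move=> s1; rewrite /block_retraction s1 subrr maxxx mul0r addr0 maxxx divr1.
Qed.

Lemma block_sum_cvg (u : nat -> 'I_r * 'I_n -> R) y l :
  (forall p, (fun k => u k p) @ \oo --> y p) ->
  (fun k => block_sum (u k) l) @ \oo --> block_sum y l.
Proof. by move=> uy; apply: (cvgn_sum (P := xpredT)) => j _; exact: uy. Qed.

Lemma maxr_cvg (c : R) (v : nat -> R) (b : R) :
  v @ \oo --> b -> (fun k => Num.max c (v k)) @ \oo --> Num.max c b.
Proof.
move=> vb; have -> : (fun k => Num.max c (v k)) =
    (fun k => (c + v k + `|c - v k|) / 2) by apply/funext => k; rewrite maxr_absE.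
rewrite maxr_absE; apply: cvgM; last exact: cvg_cst.
apply: cvgD; first by apply: cvgD => //; exact: cvg_cst.
by apply: cvg_norm; apply: cvgB => //; exact: cvg_cst.
Qed.

Lemma block_retraction_cvg (u : nat -> 'I_r * 'I_n -> R) y :
  (forall p, (fun k => u k p) @ \oo --> y p) ->
  forall p, (fun k => block_retraction (u k) p) @ \oo --> block_retraction y p.
Proof.
move=> uy p; have rs : (fun k => r%:R * block_sum (u k) p.1) @ \oo -->
    (r%:R * block_sum y p.1 : R).
  by apply: cvgM; [exact: cvg_cst|exact: block_sum_cvg].
apply: cvgM.
  apply: cvgD; first by apply: cvgM => //; exact: cvg_cst.
  apply: cvgM; last exact: cvg_cst.
  by apply: maxr_cvg; apply: cvgB => //; exact: cvg_cst.
apply: cvgV; last exact: maxr_cvg.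
by rewrite lt0r_neq0 // lt_max ltr01.
Qed.

(** The excess [G p] of [n] times the load at [p] over the total weight sums to 0 on each part.
    [kkm_dual] is applied to one simplex on all [r * n] vertices, where [F p] asks for nonpositive
    excess after retraction and for block sum at most [1 / r]. *)
Lemma exists_balanced_point (w : ('I_r * 'I_n -> R) -> edge n r -> R) :
  (forall x e, 0 <= w x e) ->
  (forall e x l, simplex_power x -> x (l, e l) = 0 -> w x e = 0) ->
  (forall e (u : nat -> 'I_r * 'I_n -> R) x,
     (forall p, (fun k => u k p) @ \oo --> x p) ->
     (fun k => w (u k) e) @ \oo --> w x e) ->
  exists2 x, simplex_power x &
    forall p, n%:R * load (w x) p <= \sum_e w x e.
Proof.
move=> w0 wfacet wcvg.
pose G p x := n%:R * load (w x) p - \sum_e w x e.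
pose F p : set ('I_r * 'I_n -> R) :=
  [set y | G p (block_retraction y) <= 0 /\ r%:R * block_sum y p.1 <= 1].
have sumG l x : \sum_j G (l, j) x = 0.
  rewrite big_split /= -mulr_sumr sum_load sumr_const card_ord.
  by rewrite -mulr_natl; ring.
have sum_block y : std_simplex R _ y -> \sum_l r%:R * block_sum y l = r%:R.
  move=> [_ y1]; rewrite -mulr_sumr /block_sum pair_bigA /=.
  by under eq_bigr do rewrite -surjective_pairing; rewrite y1 mulr1.
pose l0 : 'I_r := Ordinal (ltnW r2); pose j0 : 'I_n := Ordinal n1.
have sum_ltN (J : finType) (i : J) (f g : J -> R) :
    (forall j, f j < g j) -> \sum_j f j = \sum_j g j -> False.
  move=> fg fgE; have : \sum_j f j < \sum_j g j.
    by apply: ltr_sum => //; apply/hasP; exists i; rewrite ?mem_index_enum.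
  by rewrite fgE ltxx.
have [y yS|p u y uF uy|z zS zF] := @kkm_dual R _ (l0, j0) F.
(* The scaled block sums average 1 and the excesses of a part average 0, so each family has a member
   not above its average. *)
- have [l hl] : exists l, r%:R * block_sum y l <= 1.
    apply: contrapT => /forallNP h.
    apply: (sum_ltN _ l0 (fun=> 1) (fun l => r%:R * block_sum y l)) => [l|].
      by rewrite ltNge; apply/negP; exact: h.
    by rewrite sum_block // sumr_const card_ord.
  have [j hj] : exists j, G (l, j) (block_retraction y) <= 0.
    apply: contrapT => /forallNP h.
    apply: (sum_ltN _ j0 (fun=> 0) (fun j => G (l, j) (block_retraction y))).
      by move=> j; rewrite ltNge; apply/negP; exact: h.
    by rewrite sumG big1.
  by exists (l, j).
- have sumu : (fun k => r%:R * block_sum (u k) p.1) @ \oo -->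
      (r%:R * block_sum y p.1 : R).
    by apply: cvgM; [exact: cvg_cst|exact: block_sum_cvg].
  have wu e : (fun k => w (block_retraction (u k)) e) @ \oo -->
      w (block_retraction y) e.
    by apply: wcvg; exact: block_retraction_cvg.
  have Gu : (fun k => G p (block_retraction (u k))) @ \oo -->
      G p (block_retraction y).
    apply: cvgB; last by apply: (cvgn_sum (P := xpredT)) => e _; exact: wu.
    apply: cvgM; first exact: cvg_cst.
    by apply: cvgn_sum => e _; exact: wu.
  split; [apply: (cvgr_to_le Gu)|apply: (cvgr_to_le sumu)].
    by apply: nearW => k; exact: (uF k).2.1.
  by apply: nearW => k; exact: (uF k).2.2.
(* A block with a nonzero coordinate satisfies the second condition of [F], a zero block trivially
   does. As the scaled sums add up to [r], all equal 1. *)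
have block_le l : r%:R * block_sum z l <= 1.
  have [z0|/existsNP[j zj]] := pselect (forall j, z (l, j) = 0).
    by rewrite /block_sum big1 ?mulr0.
  by case: (zF (l, j)) => [//|[]].
have block_eq l : r%:R * block_sum z l = 1.
  apply/eqP; rewrite eq_le block_le leNgt; apply/negP => lt1.
  have := sum_block z zS; apply/eqP; rewrite lt_eqF //.
  rewrite [ltRHS](_ : _ = \sum_(k < r) 1); last by rewrite sumr_const card_ord.
  rewrite (bigD1 l) //= [ltRHS](bigD1 l) //=.
  by rewrite ltr_leD // ler_sum.
exists (block_retraction z).
  by apply: block_retraction_simplex_power => p; exact: zS.1.
move=> [l j]; case: (zF (l, j)) => [zlj|[]]; last by rewrite /G subr_le0.
(* Where [z] vanishes, so does its retraction, which is now a multiple of [z]; the facet condition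
   kills all edges through that vertex. *)
rewrite /load big1 ?mulr0 ?sumr_ge0 // => e /= /eqP elj.
apply: (wfacet _ _ l).
  by apply: block_retraction_simplex_power => p; exact: zS.1.
by rewrite elj block_retraction_homothety // zlj mulr0.
Qed.

Lemma thickened_cover_matching (B : edge n r -> set ('I_r * 'I_n -> R)) (d : R) :
  0 < d ->
  (forall x, simplex_power x -> exists e, B e x) ->
  (forall e l x, simplex_power x -> x (l, e l) = 0 -> ~ near_set (B e) d x) ->
  exists M : {set edge n r},
    [/\ is_matching M, n%:R <= (r%:R - 1) * #|M|%:R :> R &
    exists2 x, simplex_power x & forall e, e \in M -> near_set (B e) d x].
Proof.
move=> d0 cov facets.
pose w x e := bump (B e) d x.
have w0 x e : 0 <= w x e by exact: bump_ge0.
have [e x l xK xl|e u x|x xK bal] := exists_balanced_point (w := w) w0.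
- apply/eqP/negPn/negP => /(bump_neq0 _ d0); exact: facets xl.
- exact: bump_cvg.
pose W := \sum_e w x e.
have W0 : 0 < W.
  have [e Be] := cov x xK; rewrite /W (bigD1 e) //= ltr_pwDl ?sumr_ge0 //.
  rewrite lt_def w0 andbT; apply/(bump_neq0 _ d0).
  by exists x; rewrite ?l1dist_self.
(* Scaling by [n / W] makes the total weight [n], and balance says that all loads are then at most
   1. *)
have [||M [Mm Msupp Mle]] := @partite_furedi R n r (fun e => n%:R / W * w x e).
- exact: r2.
- split=> [e|p]; first by rewrite mulr_ge0 // divr_ge0 // ltW.
  by rewrite /load -mulr_sumr mulrAC ler_pdivrMr // mul1r; exact: bal.
exists M; split=> //.
  by move: Mle; rewrite -mulr_sumr mulfVK // lt0r_neq0.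
exists x => // e eM; apply/(bump_neq0 _ d0).
move: (fintype.subsetP Msupp e eM); rewrite inE mulf_eq0 negb_or => /andP[_].
by [].
Qed.

End BalancedPoint.

(** * Open and closed covers of the product *)

Section ClosedOpenCovers.
Variables (R : realType) (n r : nat).
Hypotheses (n1 : (1 <= n)%N) (r2 : (2 <= r)%N).
Local Notation V := ('I_r * 'I_n)%type.
Local Notation K := (@simplex_power R n r).
Implicit Types (x y : V -> R) (e : edge n r) (P A : set (V -> R)).

Lemma simplex_power_cvg (u : nat -> V -> R) x : (forall k, K (u k)) ->
  (forall p, (fun k => u k p) @ \oo --> x p) -> K x.
Proof.
move=> uK ux; split=> [p|i].
  by apply: (cvgr_to_ge (ux p)); apply: nearW => k; exact: (uK _).1.
have h := block_sum_cvg (l := i) ux.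
have u1 : (fun k => block_sum (u k) i) = fun=> 1.
  by apply/funext => k; exact: (uK k).2.
by apply: (cvg_unique _ h) => //; rewrite u1; exact: cvg_cst.
Qed.

Lemma simplex_power_compact (u : nat -> V -> R) : (forall k, K (u k)) ->
  exists2 f : nat -> nat, increasing_seq f &
  exists2 x, K x & forall p, (fun k => u (f k) p) @ \oo --> x p.
Proof.
move=> uK; have [|f fi [l ul]] := @pointwise_bolzano_weierstrass R V u.
  move=> k [i j]; rewrite ger0_norm ?(uK k).1 // -((uK k).2 i).
  by rewrite (bigD1 j) //= lerDl sumr_ge0 // => q _; exact: (uK k).1.
exists f => //; exists l => //.
by apply: (simplex_power_cvg _ ul) => k; exact: uK.
Qed.

(** Relative openness in the product of simplices, stated with sequences because compactness is used
    through subsequences. *)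
Definition seq_open_in P := forall (u : nat -> V -> R) x,
  (forall k, K (u k)) -> K x -> P x ->
  (forall p, (fun k => u k p) @ \oo --> x p) -> \forall k \near \oo, P (u k).

Let e_ (k : nat) : R := k.+1%:R^-1.

Lemma e_gt0 k : 0 < e_ k. Proof. by rewrite invr_gt0 ltr0n. Qed.

Lemma near_seq_cvg (f : nat -> nat) (u v : nat -> V -> R) x :
  increasing_seq f -> (forall k, l1dist (u k) (v k) < e_ k) ->
  (forall p, (fun k => u (f k) p) @ \oo --> x p) ->
  forall p, (fun k => v (f k) p) @ \oo --> x p.
Proof.
move=> fi uv ux p.
have e0 : (e_ \o f) @ \oo --> (0 : R).
  by apply: increasing_subseq_cvg => //; exact: cvg_harmonic.
apply: (@squeeze_cvgr _ _ _ _ (fun k => u (f k) p - e_ (f k))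
  (fun k => u (f k) p + e_ (f k))).
- near=> k; have : `|u (f k) p - v (f k) p| <= e_ (f k).
    apply: le_trans (ltW (uv (f k))).
    by rewrite /l1dist (bigD1 p) //= lerDl sumr_ge0.
  by rewrite ler_norml; lra.
- by rewrite -[x p]subr0; exact: cvgB (ux p) e0.
by rewrite -[x p]addr0; exact: cvgD (ux p) e0.
Unshelve. all: by end_near. Qed.

Variable A : edge n r -> set (V -> R).
Hypothesis AK : forall e, A e `<=` K.
Hypothesis cov : forall x, K x -> exists e, A e x.
Hypothesis facets : forall e l x, K x -> x (l, e l) = 0 -> ~ A e x.

Definition common_matching := exists M : {set edge n r},
  [/\ is_matching M, n%:R <= (r%:R - 1) * #|M|%:R :> R &
  exists2 x, K x & forall e, e \in M -> A e x].

Lemma open_cover_matching : (forall e, seq_open_in (A e)) -> common_matching.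
Proof.
move=> Aop.
(* A Lebesgue number of the cover: otherwise bad points accumulate at a point of some [A e], and so
   do points outside [A e]. *)
have [k hk] : exists k, forall x, K x -> exists e, forall y, K y ->
    l1dist y x < e_ k -> A e y.
  apply: contrapT => /forallNP h.
  have /choice[u uP] : forall k, exists x, K x /\ forall e, exists y,
      [/\ K y, l1dist y x < e_ k & ~ A e y].
    move=> k; have /existsNP[x /not_implyP[xK hx]] := h k.
    exists x; split=> // e; apply: contrapT => hy; apply: hx.
    exists e => y yK yx.
    by apply: contrapT => Ay; apply: hy; exists y.
  have [|f fi [x xK ux]] := @simplex_power_compact u.
    by move=> k; exact: (uP k).1.
  have [e Ae] := cov xK.
  have /choice[v vP] := fun k => (uP k).2 e.
  have vx : forall p, (fun k => v (f k) p) @ \oo --> x p.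
    apply: (near_seq_cvg fi _ ux) => k; rewrite l1dist_sym; by have [] := vP k.
  have [|N _ hN] := Aop e (v \o f) x _ xK Ae vx.
    by move=> k; have [] := vP (f k).
  by have := hN N (leqnn N); have [] := vP (f N).
(* The sets are shrunk so that their thickenings, within [K], stay inside the original ones. *)
pose B e : set (V -> R) :=
  [set x | K x /\ forall y, K y -> l1dist y x < e_ k -> A e y].
have BA e x : K x -> near_set (B e) (e_ k) x -> A e x.
  by move=> xK [b [bK hb] xb]; exact: hb.
have [x xK|e l x xK xl|M [Mm Mn [x xK hx]]] :=
    thickened_cover_matching n1 r2 (B := B) (e_gt0 k).
- by have [e he] := hk x xK; exists e.
- by move=> /(BA _ _ xK); exact: facets xl.
by exists M; split=> //; exists x => // e /hx /(BA _ _ xK).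
Qed.

(** If no matching works, then for small enough thickenings the sets still miss their facets and
    still no large matching has a common point. These are finitely many conditions, so one
    thickening meets them all and contradicts [thickened_cover_matching]. *)
Lemma closed_cover_matching :
  (forall e, seq_open_in (~` A e)) -> common_matching.
Proof.
move=> Acl; apply: contrapT => nM.
(* Closed sets without a common point on the closed set [L] keep this property after a small
   thickening: common points of the thickenings would accumulate at a common point of the sets. *)
have sep (J : finType) (F : J -> set (V -> R)) (L : set (V -> R)) :
    (forall j, F j `<=` K) -> (forall j, seq_open_in (~` F j)) ->
    (forall u x, (forall k, L (u k)) ->
      (forall p, (fun k => u k p) @ \oo --> x p) -> L x) ->
    L `<=` K ->
    (forall x, L x -> exists j, ~ F j x) ->
    \forall k \near \oo, forall x, L x -> exists j, ~ near_set (F j) (e_ k) x.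
  move=> FK Fcl Lcl LK hL; apply: contrapT => nk.
  have /choice[u uP] : forall N, exists x, L x /\ forall j, near_set (F j) (e_ N) x.
    move=> N; apply: contrapT => hN; apply: nk; exists N => // k /= Nk x Lx.
    apply: contrapT => /forallNP hx; apply: hN; exists x; split=> // j.
    have /contrapT[b Fb xb] := hx j; exists b => //.
    by apply: lt_le_trans xb _; rewrite lef_pV2 ?posrE ?ltr0n // ler_nat ltnS.
  have [|f fi [x xK ux]] := @simplex_power_compact u.
    by move=> k; exact/LK/(uP k).1.
  have Lx : L x by apply: (Lcl (u \o f)) ux => k; exact: (uP (f k)).1.
  have [j nFx] := hL x Lx.
  have /choice[v vP] : forall k, exists b, F j b /\ l1dist (u k) b < e_ k.
    by move=> k; have [b Fb ub] := (uP k).2 j; exists b.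
  have vx : forall p, (fun k => v (f k) p) @ \oo --> x p.
    by apply: (near_seq_cvg fi _ ux) => k; exact: (vP k).2.
  have [|N _ hN] := Fcl j (v \o f) x _ xK nFx vx.
    by move=> k; apply: (FK j); exact: (vP (f k)).1.
  by have := hN N (leqnn N); apply; exact: (vP (f N)).1.
have facet_near (q : edge n r * 'I_r) : \forall k \near \oo,
    forall x, K x /\ x (q.2, q.1 q.2) = 0 -> ~ near_set (A q.1) (e_ k) x.
  have := @sep unit (fun=> A q.1) [set x | K x /\ x (q.2, q.1 q.2) = 0].
  case.
  - by move=> _; exact: AK.
  - by move=> _; exact: Acl.
  - move=> u x uL ux; split.
      by apply: (simplex_power_cvg _ ux) => k; exact: (uL k).1.
    have u0 : (fun k => u k (q.2, q.1 q.2)) = fun=> 0.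
      by apply/funext => k; exact: (uL k).2.
    apply: (cvg_unique _ (ux (q.2, q.1 q.2))) => //; rewrite u0; exact: cvg_cst.
  - by move=> x [].
  - by move=> x [xK x0]; exists tt; exact: facets x0.
  move=> N _ hN; exists N => // k /hN h x /h[].
  by case.
have match_near (M : {set edge n r}) : \forall k \near \oo,
    is_matching M -> n%:R <= (r%:R - 1) * #|M|%:R :> R ->
    forall x, K x -> exists2 e, e \in M & ~ near_set (A e) (e_ k) x.
  have [[Mm Mn]|h] := pselect (is_matching M /\ n%:R <= (r%:R - 1) * #|M|%:R :> R);
    last by apply: nearW => k ? ?; case: h.
  have := @sep {e | e \in M} (fun e : {e | e \in M} => A (val e)) K.
  case.
  - by move=> e; exact: AK.
  - by move=> e; exact: Acl.
  - exact: simplex_power_cvg.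
  - by [].
  - move=> x xK; apply: contrapT => /forallNP h; apply: nM; exists M; split=> //.
    by exists x => // e eM; apply: contrapT; exact: (h (exist _ e eM)).
  move=> N _ hN; exists N => // k /hN h _ _ x /h[[e eM] he].
  by exists e.
near \oo => k.
have hf : forall q : edge n r * 'I_r, forall x, K x /\ x (q.2, q.1 q.2) = 0 ->
    ~ near_set (A q.1) (e_ k) x.
  by near: k; exact: filter_forall.
have hm : forall M : {set edge n r}, is_matching M ->
    n%:R <= (r%:R - 1) * #|M|%:R :> R -> forall x, K x -> exists2 e, e \in M & ~ near_set (A e) (e_ k) x.
  by near: k; exact: filter_forall.
have [//|e l x xK xl|M [Mm Mn [x xK hx]]] :=
    thickened_cover_matching n1 r2 (B := A) (e_gt0 k).
  exact: (hf (e, l)).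
by have [e /hx] := hm M Mm Mn x xK.
Unshelve. all: by end_near. Qed.

End ClosedOpenCovers.

(** * From barycentric coordinates to the given simplices *)

Section Realization.
Variables (R : realType) (n r : nat) (m : 'I_r -> nat).
Variable v : forall l : 'I_r, 'I_n -> 'rV[R]_(m l).

Lemma prod_topology_cvg (I : Type) (T : I -> topologicalType) (X : Type)
    (F : set_system X) (f : X -> prod_topology T) (g : prod_topology T) :
  Filter F -> (forall i, (fun x => f x i) @ F --> g i) -> f @ F --> g.
Proof.
move=> FF fg; apply/cvg_sup => i A.
rewrite (@nbhsE (initial_topology (fun f : (forall i, T i) => f i))).
move=> [_ [[W oW <-] Wg] WA]; apply: filterS WA _.
by apply: fg; apply: open_nbhs_nbhs.
Qed.

Lemma matrix_cvg (T : topologicalType) (p q : nat) (X : Type)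
    (F : set_system X) (f : X -> 'M[T]_(p, q)) (M : 'M[T]_(p, q)) :
  Filter F -> (forall i j, (fun x => f x i j) @ F --> M i j) -> f @ F --> M.
Proof.
move=> FF fM A [P MP PA]; rewrite nbhs_filterE.
suff : \forall x \near F, forall i j, P i j (f x i j).
  by apply: filterS => x; apply: PA.
by apply: filter_forall => i; apply: filter_forall => j; apply: fM; exact: MP.
Qed.

Definition realization (t : 'I_r * 'I_n -> R) : ambient R m :=
  fun l => bary_point (v l) (fun j => t (l, j)).

Lemma realization_cvg (u : nat -> 'I_r * 'I_n -> R) t :
  (forall p, (fun k => u k p) @ \oo --> t p) ->
  (fun k => realization (u k)) @ \oo --> realization t.
Proof.
move=> ut; apply: prod_topology_cvg => l; apply: matrix_cvg => i j.
rewrite /realization /bary_point summxE.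
have -> : (fun k => (\sum_(s < n) u k (l, s) *: v l s) i j) =
    (fun k => \sum_(s < n) u k (l, s) * v l s i j).
  by apply/funext => k; rewrite summxE; apply: eq_bigr => s _; rewrite mxE.
under eq_bigr do rewrite mxE.
apply: (cvgn_sum (P := xpredT)) => s _.
by apply: cvgM; [exact: ut|exact: cvg_cst].
Qed.

Lemma realization_simplex_product t :
  simplex_power t -> simplex_product v (realization t).
Proof.
by move=> [t0 t1] l; exists (fun j => t (l, j)).
Qed.

Lemma realization_facet_slab t l i : simplex_power t -> t (l, i) = 0 ->
  facet_slab v l i (realization t).
Proof.
move=> tK tli k; have [t0 t1] := tK.
have [lk|lk] := eqVneq l k.
  by subst k; rewrite dfwithin; exists (fun j => t (l, j)).
by rewrite dfwithout // ; exact: realization_simplex_product.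
Qed.

Lemma realization_seq_open (U : set (ambient R m)) :
  open (U : set (subspace (simplex_product v))) ->
  seq_open_in (fun t => U (realization t)).
Proof.
move=> oU u t uK tK Ut ut.
have := open_nbhs_nbhs (conj oU Ut : open_nbhs
  (realization t : subspace (simplex_product v)) U).
(* At a point of the product, subspace neighbourhoods are the ambient ones restricted to the
   product, so convergence of the realizations applies. *)
rewrite {1}/nbhs /= -nbhs_subspace_in; last exact: realization_simplex_product.
move=> /(realization_cvg ut) near_U.
have {near_U} : \forall k \near \oo, simplex_product v (realization (u k)) ->
  U (realization (u k)) by exact: near_U.
by apply: filterS => k; apply; exact: realization_simplex_product.
Qed.

End Realization.

Theorem theorem6 (R : realType) (n r : nat) (hn : (1 <= n)%N) (hr : (2 <= r)%N)
    (m : 'I_r -> nat) (v : forall l : 'I_r, 'I_n -> 'rV[R]_(m l))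
    (hv : forall l : 'I_r, affinely_independent (v l))
    (A : edge n r -> set (ambient R m))
    (hsub : forall e : edge n r, A e `<=` simplex_product v)
    (hcover : simplex_product v `<=` \bigcup_(e in [set: edge n r]) A e)
    (htop :
      (forall e : edge n r, open (A e : set (subspace (simplex_product v)))) \/
      (forall e : edge n r, closed (A e : set (subspace (simplex_product v)))))
    (hfacet : forall (e : edge n r) (l : 'I_r),
      A e `&` facet_slab v l (e l) = set0) :
  exists M : {set edge n r},
    [/\ is_matching M,
        (Num.ceil (n%:R / (r%:R - 1) : rat) <= #|M|%:Z)%R &
        (\bigcap_(e in [set` M]) A e) !=set0].
Proof.
(* The cover is pulled back to barycentric coordinates; a common point there is carried back by
   [realization]. *)
pose B e := [set t | simplex_power t /\ A e (realization v t)].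
have BK e : B e `<=` @simplex_power R n r by move=> t [].
have Bcov t : simplex_power t -> exists e, B e t.
  move=> tK; have [e _ Ae] := hcover _ (realization_simplex_product v tK).
  by exists e.
have Bfacet (e : edge n r) l t : simplex_power t -> t (l, e l) = 0 -> ~ B e t.
  move=> tK tl [_ Ae].
  have : (A e `&` facet_slab v l (e l)) (realization v t).
    by split=> //; exact: realization_facet_slab.
  by rewrite hfacet.
suff [M [Mm Mn [t _ hM]]] : common_matching B.
  exists M; split=> //; last by exists (realization v t) => e /= /hM[].
  (* In [R] and in [rat] alike, [r%:R - 1] is the image of a natural number, so the bound passes
     from [R] to the rational ceiling through an inequality in the naturals. *)
  have rE (S : numDomainType) : r%:R - 1 = (r - 1)%:R :> S.
    by rewrite natrB // ltnW.
  rewrite ceil_le_int ler_pdivrMr ?subr_gt0 ?ltr1n // -pmulrn.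
  by move: Mn; rewrite !rE -!natrM !ler_nat mulnC.
case: htop => [Aop|Acl].
  apply: open_cover_matching => // e u t uK tK [_ At] ut.
  by apply: filterS (realization_seq_open (Aop e) uK tK At ut) => k.
apply: closed_cover_matching => // e u t uK tK nB ut.
have nA : (~` A e) (realization v t) by move=> At; apply: nB.
have oA : open (~` A e : set (subspace (simplex_product v))) by rewrite openC.
apply: filterS (realization_seq_open oA uK tK nA ut) => k nAk [_].
exact: nAk.
Qed.
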